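(* Let $X$ be a finite alphabet, let $w\in (X\cup X^{-1})^*$ be a sparse word and let $M=\mathrm{Inv}\langle X \mid w=1\rangle$. Then the language of geodesics in the Schützenberger graph $S\Gamma(1)$ of $1$ for $M$ (i.e. the language of words in $(X\cup X^{-1})^*$ labeling geodesic edge paths starting at the vertex $1$ in $S\Gamma(1)$) is a regular language. That is, $S\Gamma(1)$ has finitely many cone types.
   Context: $X^{-1}$ is a disjoint set of formal inverses of the letters of $X$, with $(x^{-1})^{-1}=x$, and $(X\cup X^{-1})^*$ is the free monoid on $X\cup X^{-1}$; $l(\cdot)$ denotes word length. $\mathrm{Inv}\langle X\mid w=1\rangle$ is the inverse monoid presented by generators $X$ and the single relation $w=1$, i.e. the quotient of the free inverse monoid on $X$ by the congruence generated by $w=1$. Schützenberger graph. $S\Gamma(1)$ has as vertices the elements $s\in M$ with $ss^{-1}=1$, and an edge $(s,x,t)$ from $s$ to $t$ labeled $x\in X\cup X^{-1}$ whenever $ss^{-1}=tt^{-1}=1$ and $sx=t$ in $M$; the edges $(s,x,t)$ and $(t,x^{-1},s)$ are mutually inverse and form a single topological edge. It is given the path metric $d$ with edges of length 1. The cone type of a vertex $v$ is the set of words $z\in(X\cup X^{-1})^*$ that label a path in $S\Gamma(1)$ from $v$ to some vertex $v'$ with $d(1,v')=d(1,v)+l(z)$. Cyclic subwords. Let $w=a_0\cdots a_{n-1}$ with each $a_i\in X\cup X^{-1}$. A cyclic subword $q=w(i,j,\epsilon)$ of $w$, where $i,j\in\mathbb{Z}/n\mathbb{Z}$ and $\epsilon\in\{1,-1\}$,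 is a nonempty word of length at most $n-1$ of the form $q=a_i a_{i+1}\cdots a_{j-1}$ if $\epsilon=1$, and $q=a_{i-1}^{-1}a_{i-2}^{-1}\cdots a_j^{-1}$ if $\epsilon=-1$ (indices mod $n$). Its zone is the subset $\mathrm{zone}(q)=\{i,i+\epsilon,i+2\epsilon,\dots,j\}$ of $\mathbb{Z}/n\mathbb{Z}$ (the zone is attached to the triple $(i,j,\epsilon)$, not only to the word). Sparse. The word $w$ is sparse if $w$ is freely reduced, $l(w)>1$, and whenever $(q_k,q_k')=(w(i_k,j_k,\epsilon_k),w(i_k',j_k',\epsilon_k'))$, $k=1,2$, are two pairs of cyclic subwords of $w$ satisfying $q_k=q_k'$ in $(X\cup X^{-1})^*$, $\mathrm{zone}(q_k)\neq\mathrm{zone}(q_k')$ and $0\in\mathrm{zone}(q_k')$ for $k=1,2$, then: (sparse 1) $\mathrm{zone}(q_1)\cap\mathrm{zone}(q_2')=\emptyset=\mathrm{zone}(q_1')\cap\mathrm{zone}(q_2)$; and (sparse 2) either $\mathrm{zone}(q_1)\cap\mathrm{zone}(q_2)=\emptyset$, or both $\epsilon_1\epsilon_1'=\epsilon_2\epsilon_2'$ and $i_1-\epsilon_1\epsilon_1'i_1'=i_2-\epsilon_2\epsilon_2'i_2' \bmod n$. *)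

(* Defs.v *)
From HB Require Import structures.
From mathcomp Require Import all_boot all_order all_algebra.
From mathcomp Require Import boolp classical_sets functions cardinality.

Set Implicit Arguments.
Unset Strict Implicit.
Unset Printing Implicit Defensive.

(* [(x, false)] is the letter x of X and [(x, true)] its formal inverse. *)
Notation letter X := (X * bool)%type.
Notation word X := (seq (letter X)).

Definition linv (X : finType) (a : letter X) : letter X := (a.1, ~~ a.2).

Definition winv (X : finType) (u : word X) : word X := rev (map (@linv X) u).

Lemma linvK (X : finType) : involutive (@linv X).
Proof. by case=> x b; rewrite /linv /= negbK. Qed.

Lemma winvK (X : finType) : involutive (@winv X).
Proof. by move=> u; rewrite /winv map_rev revK mapK //; exact: linvK. Qed.

Lemma winv_cat (X : finType) (u v : word X) :
  winv (u ++ v) = winv v ++ winv u.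
Proof. by rewrite /winv map_cat rev_cat. Qed.

(* Defining relations of Inv<X | w = 1> as a quotient of the free monoid on
   X \cup X^-1: the first two (Wagner's relations) present the free inverse
   monoid on X. *)
Inductive inv_rel (X : finType) (w : word X) : word X -> word X -> Prop :=
| InvRelRegular u : inv_rel w (u ++ winv u ++ u) u
| InvRelIdemC u v :
    inv_rel w (u ++ winv u ++ v ++ winv v) (v ++ winv v ++ u ++ winv u)
| InvRelOne : inv_rel w w [::].

Inductive congruence_gen (A : Type) (R : seq A -> seq A -> Prop) :
    seq A -> seq A -> Prop :=
| CongRel u v : R u v -> congruence_gen R u v
| CongRefl u : congruence_gen R u u
| CongSym u v : congruence_gen R u v -> congruence_gen R v u
| CongTrans u v t :
    congruence_gen R u v -> congruence_gen R v t -> congruence_gen R u t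
| CongMul s t u v :
    congruence_gen R u v -> congruence_gen R (s ++ u ++ t) (s ++ v ++ t).

Section InverseMonoid.
Context (X : finType) (w : word X).
Implicit Types u v : word X.

Definition inv_eqv : rel (word X) :=
  fun u v => `[< congruence_gen (inv_rel w) u v >].

Lemma inv_eqv_refl : reflexive inv_eqv.
Proof. by move=> u; apply/asboolP/CongRefl. Qed.

Lemma inv_eqv_sym : symmetric inv_eqv.
Proof. by move=> u v; apply/asboolP/asboolP => /CongSym. Qed.

Lemma inv_eqv_trans : transitive inv_eqv.
Proof.
by move=> v u t /asboolP uv /asboolP vt; apply/asboolP/(CongTrans uv vt).
Qed.

Canonical inv_eqv_equiv : equiv_rel (word X) :=
  EquivRel inv_eqv inv_eqv_refl inv_eqv_sym inv_eqv_trans.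

Local Open Scope quotient_scope.

(* The monoid Inv<X | w = 1>. *)
Definition Inv : Type := {eq_quot inv_eqv}.

HB.instance Definition _ := Choice.on Inv.
HB.instance Definition _ := EqQuotient.on Inv.

Definition inv_pi (u : word X) : Inv := \pi u.

Lemma inv_piP u v :
  inv_pi u = inv_pi v <-> congruence_gen (inv_rel w) u v.
Proof.
rewrite /inv_pi; split => [/eqP|uv]; first by rewrite piE => /asboolP.
by apply/eqP; rewrite piE; apply/asboolP.
Qed.

Lemma inv_pi_repr (s : Inv) : inv_pi (repr s) = s.
Proof. exact: reprK. Qed.

Definition Inv_one : Inv := inv_pi [::].
Definition Inv_mul (s t : Inv) : Inv := inv_pi (repr s ++ repr t).
Definition Inv_inv (s : Inv) : Inv := inv_pi (winv (repr s)).

Lemma inv_pi_cat u v : Inv_mul (inv_pi u) (inv_pi v) = inv_pi (u ++ v).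
Proof.
apply/inv_piP.
have Hu : congruence_gen (inv_rel w) (repr (inv_pi u)) u.
  by apply/inv_piP; exact: inv_pi_repr.
have Hv : congruence_gen (inv_rel w) (repr (inv_pi v)) v.
  by apply/inv_piP; exact: inv_pi_repr.
apply: CongTrans (CongMul [::] _ Hu) _.
by have := CongMul u [::] Hv; rewrite !cats0.
Qed.

Lemma congruence_winv u v : congruence_gen (inv_rel w) u v ->
  congruence_gen (inv_rel w) (winv u) (winv v).
Proof.
elim=> {u v} [u v|u|u v _ /CongSym//|u v t _ uv _ /(CongTrans uv)//|s t u v _ uv].
- case=> {u v} [u|u v|].
  + rewrite !winv_cat winvK -catA; apply: CongRel.
    by have := InvRelRegular w (winv u); rewrite winvK.
  + by rewrite !winv_cat !winvK -!catA; apply/CongRel/InvRelIdemC.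
  + have ww : congruence_gen (inv_rel w) w [::] by apply/CongRel/InvRelOne.
    have www := CongRel (InvRelRegular w w).
    have /CongSym h1 := CongMul [::] (winv w ++ w) ww.
    have /CongSym h2 := CongMul (winv w) [::] ww.
    move: h1 h2; rewrite !cat0s !cats0 => h1 h2.
    exact: CongTrans h2 (CongTrans h1 (CongTrans www ww)).
- exact: CongRefl.
- by rewrite !winv_cat -!catA; exact: CongMul.
Qed.

Lemma inv_pi_inv u : Inv_inv (inv_pi u) = inv_pi (winv u).
Proof.
by apply/inv_piP/congruence_winv/inv_piP; exact: inv_pi_repr.
Qed.

Lemma Inv_mulA : associative Inv_mul.
Proof.
move=> s t r; rewrite -(inv_pi_repr s) -(inv_pi_repr t) -(inv_pi_repr r).
by rewrite !inv_pi_cat catA.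
Qed.

Lemma Inv_mul1g : left_id Inv_one Inv_mul.
Proof. by move=> s; rewrite -(inv_pi_repr s) inv_pi_cat. Qed.

Lemma Inv_mulg1 : right_id Inv_one Inv_mul.
Proof. by move=> s; rewrite -(inv_pi_repr s) inv_pi_cat cats0. Qed.

Lemma Inv_invgK : involutive Inv_inv.
Proof. by move=> s; rewrite -(inv_pi_repr s) !inv_pi_inv winvK. Qed.

Lemma Inv_invgM : {morph Inv_inv : s t / Inv_mul s t >-> Inv_mul t s}.
Proof.
move=> s t; rewrite -(inv_pi_repr s) -(inv_pi_repr t).
by rewrite inv_pi_cat !inv_pi_inv inv_pi_cat winv_cat.
Qed.

HB.instance Definition _ := isMonoid.Build Inv Inv_mulA Inv_mul1g Inv_mulg1.
HB.instance Definition _ := hasInv.Build Inv Inv_inv.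
HB.instance Definition _ := Monoid_isStarMonoid.Build Inv Inv_invgK Inv_invgM.

Local Open Scope group_scope.

Lemma inv_piM u v : inv_pi (u ++ v) = inv_pi u * inv_pi v.
Proof. by rewrite -inv_pi_cat. Qed.

(* [Inv] is an inverse monoid (regular, with commuting idempotents). *)
Lemma Inv_mulgVg (s : Inv) : s * s^-1 * s = s.
Proof.
rewrite -(inv_pi_repr s) -[X in _ * X * _]/(Inv_inv _) inv_pi_inv -!inv_piM.
by apply/inv_piP; rewrite -catA; exact/CongRel/InvRelRegular.
Qed.

Lemma Inv_mulgVC (s t : Inv) :
  (s * s^-1) * (t * t^-1) = (t * t^-1) * (s * s^-1).
Proof.
rewrite -(inv_pi_repr s) -(inv_pi_repr t).
have E u : (inv_pi u)^-1 = inv_pi (winv u) by exact: inv_pi_inv.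
rewrite !E -!inv_piM.
by apply/inv_piP; rewrite -!catA; exact/CongRel/InvRelIdemC.
Qed.

End InverseMonoid.

Section SchutzenbergerGraph.
Context (X : finType) (w : word X).
Local Open Scope group_scope.
Local Open Scope classical_set_scope.

Definition SG : Type := {s : Inv w | s * s^-1 == 1}.

Lemma SG_one_subproof : (1 : Inv w) * 1^-1 == 1.
Proof. by rewrite invg1 mulg1. Qed.

Definition SG_one : SG := exist _ 1 SG_one_subproof.

Definition SG_edge (s : SG) (a : letter X) (t : SG) : Prop :=
  val s * inv_pi w [:: a] = val t.

(* [SG_path s z t]: the word z labels an edge path from s to t. *)
Fixpoint SG_path (s : SG) (z : word X) (t : SG) : Prop :=
  if z is a :: z' then exists2 r, SG_edge s a r & SG_path r z' t else s = t.

Lemma SG_pathP s z t : SG_path s z t <-> val s * inv_pi w z = val t.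
Proof.
elim: z s => [|a z IHz] s /=.
  by rewrite mulg1; split=> [->//|/val_inj].
rewrite -cat1s inv_piM mulgA; split=> [[r rE /IHz <-]|st].
  by congr (_ * _); exact: rE.
have r1 : val s * inv_pi w [:: a] * (val s * inv_pi w [:: a])^-1 == 1.
  set r := val s * _ in st *.
  have rV : r * (inv_pi w z * (val t)^-1) = 1.
    by rewrite mulgA st; exact/eqP/(valP t).
  by apply/eqP; rewrite -[LHS]mulg1 -[X in _ * X = _]rV mulgA Inv_mulgVg.
by exists (exist (fun s : Inv w => s * s^-1 == 1) _ r1); last exact/IHz.
Qed.

Lemma SG_connected s t :
  exists n, `[< exists2 z, SG_path s z t & size z = n >].
Proof.
exists (size (repr ((val s)^-1 * val t))); apply/asboolP.
exists (repr ((val s)^-1 * val t)) => //; apply/SG_pathP.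
by rewrite inv_pi_repr mulgA (eqP (valP s)) mul1g.
Qed.

Definition SG_dist (s t : SG) : nat := ex_minn (SG_connected s t).

Definition cone_type (v : SG) : set (word X) :=
  [set z | exists2 v', SG_path v z v' &
             SG_dist SG_one v' = (SG_dist SG_one v + size z)%N].

Definition geodesic_label (s : SG) (z : word X) : Prop :=
  exists2 t, SG_path s z t & SG_dist s t = size z.

Definition geodesic_language : set (word X) :=
  [set z | geodesic_label SG_one z].

End SchutzenbergerGraph.

(* Recognizable by a deterministic complete finite automaton. *)
Definition regular_language (A : finType) (L : set (seq A)) : Prop :=
  exists (Q : finType) (q0 : Q) (delta : Q -> A -> Q) (F : {set Q}),
    forall z, L z <-> foldl delta q0 z \in F.

Definition freely_reduced (X : finType) (w : word X) : bool :=
  sorted (fun a b => b != linv a) w.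

Section CyclicSubwords.
Context (X : finType) (w : word X).

(* A triple (i, j, epsilon) with epsilon = (-1) ^ [cs_neg]. The length of
   w(i, j, epsilon) is the residue of epsilon * (j - i) in {0, ..., n - 1}, so
   that [i != j] says exactly that it is between 1 and n - 1. The type
   ['Z_(size w)] is Z / n only for 1 < n; [sparse] imposes this. *)
Record cyclic_subword := CyclicSubword {
  cs_start : 'Z_(size w);
  cs_stop : 'Z_(size w);
  cs_neg : bool;
  _ : cs_start != cs_stop }.

(* a_i a_(i + 1) ... a_(j - 1), with indices mod n. *)
Definition cyclic_factor (i j : 'Z_(size w)) : word X :=
  take (j - i)%R (rot i w).

(* For epsilon = -1, a_(i - 1)^-1 ... a_j^-1 = (a_j ... a_(i - 1))^-1. *)
Definition cs_word (q : cyclic_subword) : word X :=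
  if cs_neg q then winv (cyclic_factor (cs_stop q) (cs_start q))
  else cyclic_factor (cs_start q) (cs_stop q).

Definition cs_sign (q : cyclic_subword) : int := ((-1) ^+ cs_neg q)%R.

Definition zone (q : cyclic_subword) : {set 'Z_(size w)} :=
  [set (cs_start q + (cs_sign q)%:~R *+ k)%R | k : 'I_(size (cs_word q)).+1].

Definition cs_offset (q q' : cyclic_subword) : 'Z_(size w) :=
  (cs_start q - (cs_sign q * cs_sign q')%:~R * cs_start q')%R.

Definition sparse_pair (q q' : cyclic_subword) : Prop :=
  [/\ cs_word q = cs_word q', zone q <> zone q' & 0%R \in zone q'].

Definition sparse : Prop :=
  [/\ freely_reduced w, (1 < size w)%N &
    forall q1 q1' q2 q2' : cyclic_subword,
      sparse_pair q1 q1' -> sparse_pair q2 q2' ->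
      (zone q1 :&: zone q2' = finset.set0 /\
       zone q1' :&: zone q2 = finset.set0) /\
      (zone q1 :&: zone q2 = finset.set0 \/
       ((cs_sign q1 * cs_sign q1' = cs_sign q2 * cs_sign q2')%R /\
        cs_offset q1 q1' = cs_offset q2 q2'))].

End CyclicSubwords.

(* Main.v *)
Require Import Defs.
From mathcomp Require Import all_boot all_order all_algebra.
From mathcomp Require Import boolp classical_sets functions cardinality.
From mathcomp Require Import zify ring.

Set Implicit Arguments.
Unset Strict Implicit.
Unset Printing Implicit Defensive.

Import GRing.Theory.

(** A vertex of the Schuetzenberger graph of [1] is the base of exactly one
    closed path labelled [w], so the graph is a union of copies of the cycle of
    length [n = size w] that spells [w], one for each vertex. It is built by
    starting from one such cycle and, at every vertex that has none yet, sewing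
    on a child cycle and folding it with the cycle on which the vertex appeared,
    as far as the labels agree.

    Sparseness says how these foldings interact. On a child, call gate the
    interval of positions that get folded with the parent; its image is the part
    of the parent that is folded with the child. The part of a cycle folded with
    a child is disjoint from every gate ([fold_notin_gate]), so a vertex of a
    gate never takes part in a folding with a child; and a cycle is folded with
    different children along disjoint parts ([fold_glued_inj]). Hence one round
    of foldings at each new cycle is final, and the graph is a tree of cycles in
    which a vertex is described by the sequence of positions chosen on
    successive cycles. That this explicit graph is deterministic ([step_det])
    is where sparseness is used; being deterministic, closed under inverse
    edges, and having a closed path [w] at every vertex, it is acted upon by the
    monoid ([walk_congruence]), and this identifies it with the Schuetzenberger
    graph.

    A gate and its image are disjoint intervals of the same size on a cycle, so
    a gate covers at most half of its cycle. A shortest path to a vertex outside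
    the gate therefore enters the cycle through one of the two ends of the gate
    and does not leave the cycle again: the distances on a cycle are determined
    by those on the gate ([arc_dist]). Up to an additive constant only finitely
    many families of distances occur on a cycle, since neighbours are at
    distances differing by at most one. Together with the position of the
    cycle on its parent, such a family determines the families on the children,
    so it serves as the state of a finite automaton that follows geodesics
    ([edge_state]).

    The one sparse relator for which a child is folded with its parent all the
    way round is [a a]; its graph has two vertices and is treated apart. *)

(** * Right units *)

Section RightUnits.
Context (X : finType) (w : word X).
Local Open Scope group_scope.
Implicit Types (s t : Defs.Inv w) (a : letter X).

Lemma inv_pi_linv a : inv_pi w [:: linv a] = (inv_pi w [:: a])^-1.
Proof. by rewrite -[RHS]/(Inv_inv _) inv_pi_inv. Qed.

Lemma right_unit_factor s t : s * t = 1 -> s * s^-1 = 1.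
Proof. by move=> st; rewrite -[LHS]mulg1 -st mulgA Inv_mulgVg. Qed.

Lemma right_unitM s t : s * s^-1 = 1 -> t * t^-1 = 1 -> (s * t) * (s * t)^-1 = 1.
Proof. by move=> ss tt; rewrite invgM mulgA -(mulgA s) tt mulg1. Qed.

Lemma inv_pi_relator : inv_pi w w = 1.
Proof. by apply/inv_piP/CongRel/InvRelOne. Qed.

(** This is where idempotents commute: [s a a^-1 = s (s^-1 s) (a a^-1)], and
    exchanging the two idempotents gives [(s a) (s a)^-1 s = s]. *)
Lemma right_unit_back s t a :
  t * t^-1 = 1 -> s * inv_pi w [:: a] = t -> t * inv_pi w [:: linv a] = s.
Proof.
move=> + st; rewrite -{}st => sa.
rewrite inv_pi_linv; set b := inv_pi w [:: a] in sa *.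
have := Inv_mulgVC s^-1 b; rewrite invgK => E.
rewrite -{1}(Inv_mulgVg s) -!mulgA (mulgA s^-1) (mulgA (s^-1 * s)).
by rewrite -(mulgA (s^-1 * s)) E !mulgA -(mulgA (s * b)) -invgM sa mul1g.
Qed.

Definition SG_of s (ss : s * s^-1 = 1) : SG w :=
  exist (fun s : Defs.Inv w => s * s^-1 == 1) s (introT eqP ss).

End RightUnits.

(** * Recognising the Schuetzenberger graph *)

Section Model.
Context (X : finType) (w : word X).
Context (V : Type) (root : V) (E : V -> letter X -> V -> Prop).
Implicit Types (v t r : V) (a : letter X) (z u : word X).

(** [E] is meant to be the edge relation of the Schuetzenberger graph, on a
    concrete set of vertices. *)
Fixpoint walk v z t : Prop :=
  if z is a :: z' then exists2 r, E v a r & walk r z' t else v = t.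

Hypothesis E_inv : forall v a t, E v a t -> E t (linv a) v.
Hypothesis E_det : forall v a t t', E v a t -> E v a t' -> t = t'.
Hypothesis E_loop : forall v, walk v w v.

Lemma walk_cat v z z' t :
  walk v (z ++ z') t <-> exists2 r, walk v z r & walk r z' t.
Proof.
elim: z v => [|a z IHz] v /=.
  by split=> [vt|[r <-]//]; exists v.
split=> [[r Er /IHz[r' zr z't]]|[r' [r Er zr] z't]].
  by exists r' => //; exists r.
by exists r => //; apply/IHz; exists r'.
Qed.

Lemma walk_winv v z t : walk v z t -> walk t (winv z) v.
Proof.
elim: z v => [|a z IHz] v /=; first by move=> ->.
case=> r /E_inv Er /IHz zr; rewrite -[a :: z]/([:: a] ++ z) winv_cat.
by apply/walk_cat; exists r => //; exists v.
Qed.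

Lemma walk_det v z t t' : walk v z t -> walk v z t' -> t = t'.
Proof.
elim: z v => [|a z IHz] v /=; first by move=> -> ->.
case=> r Er zr [r' Er']; rewrite -(E_det Er Er').
exact: IHz.
Qed.

(** Words act on the vertices by partial injections that [w] fixes pointwise,
    so this action factors through [Inv w]. *)
Lemma walk_congruence z z' :
  congruence_gen (inv_rel w) z z' -> forall v t, walk v z t <-> walk v z' t.
Proof.
have idem v u t : walk v (u ++ winv u) t <-> v = t /\ exists r, walk v u r.
  split=> [/walk_cat[r ur /walk_winv]|[<- [r ur]]].
    rewrite winvK => ur'; split; last by exists r.
    by apply: walk_det (walk_winv ur) _; apply: walk_winv.
  by apply/walk_cat; exists r => //; exact: walk_winv.
elim=> {z z'} [z z' [] {z z'}|z|z z' _ IH|z z' z'' _ IH _ IH'|s s' z z' _ IH].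
- move=> u v t; rewrite catA walk_cat; split=> [[r /idem[<-]]//|ut].
  by exists v => //; apply/idem; split=> //; exists t.
- move=> u u' v t; rewrite !(catA _ _ (_ ++ _)).
  split=> /walk_cat[r /idem[<- eu] /idem[<- eu']];
    by apply/walk_cat; exists v; apply/idem.
- move=> v t; split=> [ww|<-]; last exact: E_loop.
  exact: walk_det (E_loop v) ww.
- by [].
- by move=> v t; rewrite IH.
- by move=> v t; rewrite IH.
- move=> v t; split=> /walk_cat[r sr /walk_cat[r' zr' s't]];
    by apply/walk_cat; exists r => //; apply/walk_cat; exists r' => //; apply/IH.
Qed.

(** [h] realises the vertices in the monoid, and [delta] is a candidate for the
    distance to the root: [delta_edge] bounds it from above by the length of a
    walk, and [delta_down] yields a walk of that length. *)
Context (h : V -> SG w) (delta : V -> nat).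
Hypothesis h_root : h root = SG_one w.
Hypothesis h_edge : forall v a t, E v a t -> SG_edge (h v) a (h t).
Hypothesis delta_root : delta root = 0.
Hypothesis delta_edge : forall v a t, E v a t -> delta t <= (delta v).+1.
Hypothesis delta_down : forall v,
  v = root \/ exists r a, E r a v /\ delta v = (delta r).+1.

Lemma delta_walk v z t : walk v z t -> delta t <= delta v + size z.
Proof.
elim: z v => [|a z IHz] v /=; first by move=> ->; rewrite addn0.
case=> r /delta_edge Er /IHz/leq_trans; apply.
by rewrite addnS -addSn leq_add2r.
Qed.

Lemma walk_geodesic v : exists2 z, walk root z v & size z = delta v.
Proof.
have [m] := ubnP (delta v); elim: m v => // m IHm v lt_vm.
have [->|[u [a [Eua dv]]]] := delta_down v.
  by exists [::]; rewrite ?delta_root.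
have [|z zu sz] := IHm u; first by rewrite dv in lt_vm.
exists (rcons z a); last by rewrite size_rcons sz.
by rewrite -cats1; apply/walk_cat; exists u => //; exists v.
Qed.

Lemma SG_path_walk v z t : walk v z t -> SG_path (h v) z (h t).
Proof.
by elim: z v => [|a z IHz] v /=; [move=> ->|case=> r /h_edge ? /IHz; exists (h r)].
Qed.

Local Open Scope group_scope.

(** If [z] labels a path from [h v], and [y] leads to [v], then
    [y z (y z)^-1 = 1] in the monoid; since words act on [V] through the monoid,
    [y z (y z)^-1] can be walked from the root, and so can its prefix [y z]. *)
Lemma walk_SG_path v z s :
  SG_path (h v) z s -> exists2 t, walk v z t & h t = s.
Proof.
move=> zs; have [y yv _] := walk_geodesic v.
have hv : val (h v) = inv_pi w y.
  by move/SG_path_walk/SG_pathP: yv; rewrite h_root mul1g.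
have hs : val s = inv_pi w (y ++ z) by move/SG_pathP: zs; rewrite hv inv_piM.
have : inv_pi w ((y ++ z) ++ winv (y ++ z)) = inv_pi w [::].
  by rewrite inv_piM -inv_pi_inv -hs; exact: eqP (valP s).
move/inv_piP/walk_congruence/(_ root root) => [_ /(_ erefl)].
case/walk_cat=> t /walk_cat[v' yv' zt] _.
move: zt; rewrite -(walk_det yv yv') => zt; exists t => //.
by apply: val_inj; move/SG_path_walk/SG_pathP: (zt) => <-; rewrite hv hs inv_piM.
Qed.

Lemma walk_SG_path1 z s :
  SG_path (SG_one w) z s -> exists2 t, walk root z t & h t = s.
Proof. by rewrite -h_root; exact: walk_SG_path. Qed.

Lemma h_surj s : exists v, h v = s.
Proof.
have [|v _ <-] := @walk_SG_path1 (repr (val s)) s; last by exists v.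
by apply/SG_pathP; rewrite mul1g inv_pi_repr.
Qed.

Lemma h_inj v t : h v = h t -> v = t.
Proof.
have [y yv _] := walk_geodesic v; have [z zt _] := walk_geodesic t.
have := SG_path_walk zt; have := SG_path_walk yv.
move=> /SG_pathP yE /SG_pathP zE vt; move: yE zE; rewrite vt h_root !mul1g => <-.
by move=> /inv_piP/walk_congruence/(_ root t)[/(_ zt) yt _]; apply: walk_det yv yt.
Qed.

Local Close Scope group_scope.

Lemma SG_dist_root v : SG_dist (SG_one w) (h v) = delta v.
Proof.
rewrite /SG_dist; case: ex_minnP => m /asboolP[z /walk_SG_path1[t zt /h_inj tv] <-].
move=> zmin; have [y yv sy] := walk_geodesic v.
have : size z <= size y.
  by apply/zmin/asboolP; exists y => //; rewrite -h_root; apply: SG_path_walk.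
by have := delta_walk zt; rewrite delta_root tv sy; lia.
Qed.

(** Along an edge [delta] grows by at most one, so a walk of length [m] raises
    [delta] by [m] exactly when each of its edges raises it by one: being a
    geodesic continuation is a local condition. *)
Fixpoint ascends v z : Prop :=
  if z is a :: z' then exists t, [/\ E v a t, delta t = (delta v).+1 & ascends t z']
  else True.

Lemma ascendsP v z :
  ascends v z <-> exists2 t, walk v z t & delta t = delta v + size z.
Proof.
elim: z v => [|a z IHz] v /=.
  by split=> // _; exists v; rewrite ?addn0.
split=> [[r [Er dr /IHz[t zt dt]]]|[t [r Er zt] dt]].
  by exists t; [exists r|rewrite dt dr addSnnS].
have := delta_edge Er; have := delta_walk zt => le1 le2.
by exists r; split=> //; [lia|apply/IHz; exists t => //; lia].
Qed.

Lemma cone_typeP v z : cone_type (h v) z <-> ascends v z.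
Proof.
rewrite ascendsP /cone_type /=; split=> [[s zs]|[t zt dt]].
  have [t zt <-] := walk_SG_path zs; rewrite !SG_dist_root => dt.
  by exists t.
by exists (h t); [exact: SG_path_walk|rewrite !SG_dist_root].
Qed.

Lemma geodesic_languageP z : geodesic_language w z <-> ascends root z.
Proof.
rewrite -cone_typeP /cone_type h_root /geodesic_language /geodesic_label /=.
have d11 : SG_dist (SG_one w) (SG_one w) = 0.
  by rewrite -h_root -delta_root -SG_dist_root h_root.
by rewrite d11 add0n; split=> -[t zt dt]; exists t.
Qed.

(** Vertices in the same state have matching ascending edges, leading to equal
    states again; so the cone type only depends on the state. *)
Context (Q : finType) (state : V -> Q).
Hypothesis state_edge : forall v v' a t,
  state v = state v' -> E v a t -> delta t = (delta v).+1 ->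
  exists t', [/\ E v' a t', delta t' = (delta v').+1 & state t' = state t].

Lemma ascends_state v v' z : state v = state v' -> ascends v z -> ascends v' z.
Proof.
elim: z v v' => [|a z IHz] v v' //= vv' [t [Et dt zt]].
have [t' [Et' dt' tt']] := state_edge vv' Et dt.
by exists t'; split=> //; apply: IHz zt.
Qed.

Lemma finite_cone_types : finite_set (range (cone_type (w := w))).
Proof.
pose g (q : Q) : set (word X) := [set z | exists v, state v = q /\ ascends v z]%classic.
apply: (@sub_finite_set _ _ (range g)); last exact/finite_image/finite_finset.
move=> _ [s _ <-]; have [v <-] := h_surj s; exists (state v) => //.
apply/seteqP; split=> z /=; rewrite cone_typeP; last by exists v.
by case=> v' [/ascends_state]; apply.
Qed.

(** The states are those of an automaton for the ascending walks, with [None] as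
    its failure state; a transition is read off from any vertex in the state. *)
Definition up_edge q a t : Prop :=
  exists v, [/\ state v = q, E v a t & delta t = (delta v).+1].

Definition up_step (o : option Q) a : option Q :=
  if o is Some q then
    if pselect (exists t, up_edge q a t) is left e then Some (state (projT1 (cid e)))
    else None
  else None.

Lemma up_step_ascends v z :
  ascends v z <-> foldl up_step (Some (state v)) z != None.
Proof.
elim: z v => [|a z IHz] v //=.
case: pselect => [e|ne]; last first.
  have -> : foldl up_step None z = None by elim: z {IHz}.
  split=> // -[t [Et dt _]]; case: ne; exists t; exists v; by split.
case: (cid e) => t /= [v' [v'v Et dt]]; rewrite -IHz.
have [t' [Et' dt' tt']] := state_edge v'v Et dt.
split=> [[r [Er dr zr]]|/(ascends_state (esym tt')) zt']; last by exists t'.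
by apply: (ascends_state tt'); rewrite (E_det Et' Er).
Qed.

Theorem regular_of_model :
  regular_language (geodesic_language w) /\ finite_set (range (cone_type (w := w))).
Proof.
split; last exact: finite_cone_types.
exists (option Q), (Some (state root)), up_step, [set~ None] => z.
by rewrite geodesic_languageP up_step_ascends !inE.
Qed.

End Model.

(** * Laying a cycle on another one *)

Section CyclicWord.
Context (X : finType) (w : word X) (x0 : letter X).
Hypothesis n_gt1 : 1 < size w.
Local Notation n := (size w).
Local Notation Zn := 'Z_n.
Implicit Types (p k c : Zn) (e : bool) (r s t : nat).
Local Open Scope ring_scope.

Lemma natZ_inj r s : (r < n)%N -> (s < n)%N -> r%:R = s%:R :> Zn -> r = s.
Proof.
by move=> rn sn /(congr1 val); rewrite /= !val_Zp_nat // !modn_small.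
Qed.

Lemma val_natZ r : (r < n)%N -> (r%:R : Zn) = r :> nat.
Proof. by move=> rn; rewrite val_Zp_nat // modn_small. Qed.

Lemma ltn_Zn p : (p < n)%N.
Proof. by have := ltn_ord p; rewrite [X in (_ < X)%N]Zp_cast. Qed.

Lemma natZn : n%:R = 0 :> Zn.
Proof. by apply/val_inj; rewrite /= val_Zp_nat // modnn. Qed.

Lemma card_Zn : #|Zn| = n.
Proof. by rewrite card_ord Zp_cast. Qed.

Definition sg e : Zn := if e then -1 else 1.

Lemma sgK e p : sg e * (sg e * p) = p.
Proof. by case: e; rewrite /sg; ring. Qed.

Lemma sgN e : sg (~~ e) = - sg e.
Proof. by case: e; rewrite /sg //= opprK. Qed.

Lemma sg_addb e e' : sg (e (+) e') = sg e * sg e'.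
Proof. by case: e; case: e'; rewrite /sg /=; ring. Qed.

Definition letter_at p : letter X := nth x0 w p.

(** The letter read on the cycle on leaving [p] in direction [sg e]. *)
Definition out p e : letter X :=
  if e then linv (letter_at (p - 1)) else letter_at p.

Lemma out_linv p e : out (p + sg e) (~~ e) = linv (out p e).
Proof.
case: e; rewrite /out /sg /=; first by rewrite linvK.
by rewrite addrK.
Qed.

(** A second cycle is laid on the first one with its base at [k], reversed if
    [e]: its position [p] covers position [align k e p]. *)
Definition align k e p : Zn := k + sg e * p.

Lemma align_inj k e : injective (align k e).
Proof. by move=> p p' /addrI /(congr1 ( *%R (sg e))); rewrite !sgK. Qed.

Lemma alignD k e p e' : align k e (p + sg e') = align k e p + sg (e (+) e').
Proof. by rewrite /align sg_addb mulrDr addrA. Qed.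

Lemma align0 k e : align k e 0 = k.
Proof. by rewrite /align mulr0 addr0. Qed.

(** This concerns the edge from [p] to [p + 1] of the second cycle; if [e], the
    edge that it covers is read backwards. *)
Definition edge_match k e p : bool := out p false == out (align k e p) e.

Lemma out_edge_match k e p e' :
  (out p e' == out (align k e p) (e (+) e')) =
  edge_match k e (if e' then p - 1 else p).
Proof.
case: e'; last by rewrite addbF.
have pE : p = p - 1 + sg false by rewrite /sg subrK.
rewrite {1 2}pE alignD addbF addbT (out_linv _ false) out_linv /edge_match.
by rewrite (inj_eq (can_inj (@linvK X))).
Qed.

(** How far a match extends from the base, at most once around the cycle. *)
Definition arm (P : pred nat) : nat := find (predC P) (iota 0 n).

Lemma arm_le P : (arm P <= n)%N.
Proof. by rewrite -[X in (_ <= X)%N](size_iota 0) find_size. Qed.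

Lemma arm_before P r : (r < arm P)%N -> P r.
Proof.
move=> rP; have rn := leq_trans rP (arm_le P).
by have := before_find 0%N rP; rewrite nth_iota // add0n /= => /negbFE.
Qed.

Lemma arm_max P : (arm P < n)%N -> ~~ P (arm P).
Proof.
move=> Pn; have := Pn; rewrite -[X in (_ < X)%N](size_iota 0) -has_find.
by move/(nth_find 0%N); rewrite nth_iota.
Qed.

Definition arm_fwd k e := arm (fun r => edge_match k e r%:R).
Definition arm_bwd k e := arm (fun r => edge_match k e (- r.+1%:R)).

Definition run k e s t :=
  forall r, (r < s + t)%N -> edge_match k e (r%:R - s%:R).

Lemma run_arms k e s t :
  (s <= arm_bwd k e)%N -> (t <= arm_fwd k e)%N -> run k e s t.
Proof.
move=> sS tT r rst; have [rs|sr] := ltnP r s.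
  have sr : (s - r.+1 < arm_bwd k e)%N by lia.
  have := arm_before sr; congr edge_match.
  by rewrite -subSn // subSS natrB ?opprB // ltnW.
have rT : (r - s < arm_fwd k e)%N by lia.
by have := arm_before rT; congr edge_match; rewrite natrB.
Qed.

Definition interval s t : {set Zn} := [set r%:R - s%:R | r : 'I_(s + t).+1].

Lemma intervalP s t p :
  reflect (exists2 r, (r <= s + t)%N & p = r%:R - s%:R) (p \in interval s t).
Proof.
apply: (iffP imsetP) => [[r _ ->]|[r rst ->]]; first by exists r => //; rewrite -ltnS.
by exists (Ordinal (rst : (r < (s + t).+1)%N)).
Qed.

Lemma zero_interval s t : 0 \in interval s t.
Proof. by apply/intervalP; exists s; rewrite ?leq_addr ?subrr. Qed.

Lemma card_interval s t : (s + t < n)%N -> #|interval s t| = (s + t).+1.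
Proof.
move=> stn; rewrite card_imset ?card_ord // => r r' /addIr rr'.
by apply/val_inj/(natZ_inj _ _ rr'); apply: leq_trans (ltn_ord _) stn.
Qed.

Lemma interval_sub s t s' t' :
  (s' <= s)%N -> (t' <= t)%N -> interval s' t' \subset interval s t.
Proof.
move=> ss tt; apply/fintype.subsetP => p /intervalP[r rst ->]; apply/intervalP.
by exists (r + (s - s'))%N; [lia|rewrite natrD natrB //; ring].
Qed.

Lemma size_cyclic_factor (i j : Zn) : size (cyclic_factor i j) = (j - i)%R.
Proof.
by rewrite size_take size_rot; case: ltnP => // nji; have := ltn_Zn (j - i); lia.
Qed.

Lemma nth_cyclic_factor (i j : Zn) r :
  (r < (j - i)%R)%N -> nth x0 (cyclic_factor i j) r = letter_at (i + r%:R).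
Proof.
move=> rji; have rn := ltn_trans rji (ltn_Zn _).
have i_n := ltn_Zn i.
rewrite /letter_at nth_take // nth_cat size_drop nth_drop.
have -> : (i + r%:R : Zn) = ((i + r) %% n)%N :> nat.
  by rewrite -[i in LHS]natr_Zp -natrD val_Zp_nat.
case: ltnP => rni; first by rewrite modn_small //; lia.
rewrite nth_take; last by lia.
congr nth; have -> : (i + r = (r - (n - i)) + n)%N by lia.
by rewrite modnDr modn_small //; lia.
Qed.

Lemma cs_wordE (i j : Zn) e (ij : i != j) (m : nat) :
  (m < n)%N -> j = i + sg e * m%:R ->
  cs_word (CyclicSubword e ij) = mkseq (fun r => out (i + sg e * r%:R) e) m.
Proof.
move=> mn jE; rewrite /cs_word /=; case: e jE; rewrite /sg => jE.
  have ji : (i - j)%R = m :> nat.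
    by rewrite -[RHS](val_natZ mn); congr val; rewrite jE; ring.
  have sz : size (cyclic_factor j i) = m by rewrite size_cyclic_factor ji.
  apply: (@eq_from_nth _ x0); first by rewrite size_rev size_map size_mkseq sz.
  rewrite size_rev size_map sz => r rm.
  rewrite nth_mkseq // nth_rev ?size_map ?sz // (nth_map x0) ?sz; last by lia.
  rewrite nth_cyclic_factor ?ji; last by lia.
  by rewrite /out; congr (linv (letter_at _)); rewrite jE natrB // -natr1; ring.
have ji : (j - i)%R = m :> nat.
  by rewrite -[RHS](val_natZ mn); congr val; rewrite jE; ring.
apply: (@eq_from_nth _ x0); first by rewrite size_cyclic_factor size_mkseq ji.
rewrite size_cyclic_factor ji => r rm; rewrite nth_mkseq // nth_cyclic_factor ?ji //.
by rewrite mul1r.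
Qed.

Lemma cs_signE (q : cyclic_subword w) : (cs_sign q)%:~R = sg (cs_neg q).
Proof. by rewrite /cs_sign; case: (cs_neg q). Qed.

Lemma zoneE (i j : Zn) e (ij : i != j) (m : nat) :
  (m < n)%N -> j = i + sg e * m%:R ->
  zone (CyclicSubword e ij) = [set i + sg e * r%:R | r : 'I_m.+1].
Proof.
move=> mn jE; rewrite /zone (cs_wordE ij mn jE) size_mkseq.
by apply: eq_imset => r; rewrite cs_signE /= mulr_natr.
Qed.

(** The second subword is read forwards and the first one in the direction in
    which it gets covered; the offset of the pair is then the place [k] of the
    base. *)
Lemma run_sparse_pair k e s t : (0 < s + t < n)%N -> run k e s t ->
  align k e @: interval s t != interval s t ->
  exists q q', [/\ sparse_pair q q',
    [/\ zone q = align k e @: interval s t & zone q' = interval s t],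
    cs_sign q = (-1) ^+ e, cs_sign q' = 1 & cs_offset q q' = k].
Proof.
case/andP=> st0 stn kst neq.
have m0 : (s + t)%:R != 0 :> Zn.
  by apply/eqP => /(@natZ_inj _ 0%N stn (ltnW n_gt1)) E; rewrite E in st0.
have jE : align k e t%:R = align k e (- s%:R) + sg e * (s + t)%:R.
  by rewrite /align natrD; ring.
have jE' : t%:R = - s%:R + sg false * (s + t)%:R :> Zn.
  by rewrite /sg natrD; ring.
have ij' : - s%:R != t%:R :> Zn.
  by rewrite jE' -subr_eq0 opprD addrA subrr add0r oppr_eq0 mul1r.
have ij : align k e (- s%:R) != align k e t%:R by rewrite (inj_eq (@align_inj k e)).
have zE : zone (CyclicSubword e ij) = align k e @: interval s t.
  rewrite (zoneE ij stn jE) -imset_comp; apply: eq_imset => r /=.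
  by rewrite /align; ring.
have zE' : zone (CyclicSubword false ij') = interval s t.
  by rewrite (zoneE ij' stn jE'); apply: eq_imset => r /=; rewrite /sg mul1r addrC.
exists (CyclicSubword e ij), (CyclicSubword false ij'); split=> //; last first.
  by rewrite /cs_offset intrM !cs_signE /align /sg /=; ring.
split; last by rewrite zE' zero_interval.
  rewrite (cs_wordE ij stn jE) (cs_wordE ij' stn jE'); apply/eq_in_map => r.
  rewrite mem_iota add0n => /andP[_ /kst/eqP/esym].
  rewrite /align /sg mul1r [- _ + _]addrC => <-.
  by congr out; ring.
by rewrite zE zE'; apply/eqP.
Qed.

(** * Consequences of sparseness *)

Hypothesis w_sparse : sparse w.

Lemma sparse_runs k1 e1 s1 t1 k2 e2 s2 t2 :
  (0 < s1 + t1 < n)%N -> run k1 e1 s1 t1 ->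
  align k1 e1 @: interval s1 t1 != interval s1 t1 ->
  (0 < s2 + t2 < n)%N -> run k2 e2 s2 t2 ->
  align k2 e2 @: interval s2 t2 != interval s2 t2 ->
  [disjoint align k1 e1 @: interval s1 t1 & interval s2 t2] /\
  ([disjoint align k1 e1 @: interval s1 t1 & align k2 e2 @: interval s2 t2] \/
   e1 = e2 /\ k1 = k2).
Proof.
move=> st1 run1 neq1 st2 run2 neq2.
have [q1 [q1' [sp1 [z1 _] g1 g1' o1]]] := run_sparse_pair st1 run1 neq1.
have [q2 [q2' [sp2 [z2 z2'] g2 g2' o2]]] := run_sparse_pair st2 run2 neq2.
have [_ _ /(_ _ _ _ _ sp1 sp2)] := w_sparse.
rewrite z1 z2 z2' g1 g1' g2 g2' o1 o2 !mulr1 => -[[d12 _] d].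
split; first by rewrite -setI_eq0 d12.
case: d => [d|[ee kk]]; [by left; rewrite -setI_eq0 d|right; split=> //].
by case: (e1) (e2) ee => -[].
Qed.

Lemma sparse_letters p : p != 0 -> letter_at p != linv (letter_at (p - 1)).
Proof.
move=> p0; have [/(sortedP x0) sw _ _] := w_sparse.
have p0' : (0 < p)%N by rewrite lt0n.
have pE : p.-1.+1 = p :> nat by rewrite prednK.
have := sw p.-1; rewrite pE => /(_ (ltn_Zn _)).
suff <- : (p - 1)%R = p.-1 :> nat by [].
have -> : p - 1 = p.-1%:R by rewrite -[p in LHS]natr_Zp -{1}pE -natr1 addrK.
by rewrite val_natZ // (leq_ltn_trans (leq_pred _)) // ltn_Zn.
Qed.

Lemma two_neq0 : (2 < n)%N -> 2%:R != 0 :> Zn.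
Proof. by move=> n2; apply/eqP => /(@natZ_inj 2 0 n2 (ltnW n_gt1)). Qed.

Lemma interval_edge s t : (s + t = 1)%N ->
  interval s t = [set - s%:R; - s%:R + 1].
Proof.
move=> st1; apply/setP => p; rewrite in_set2; apply/intervalP/orP => [[r]|].
  rewrite st1; case: r => [|[|r]] // _ ->; first by left; rewrite sub0r.
  by right; rewrite addrC.
by case=> /eqP->; [exists 0%N; rewrite ?sub0r|exists 1%N; rewrite ?st1 // addrC].
Qed.

(** An edge cannot be matched with itself: preserving its orientation forces
    the alignment to be trivial, reversing it would make a letter equal to its
    own inverse. *)
Lemma edge_match_neq k e p : (2 < n)%N -> k != 0 -> edge_match k e p ->
  align k e @: [set p; p + 1] != [set p; p + 1].
Proof.
move=> n2 k0 kep; apply/eqP => E.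
have pE : align k e p \in [set p; p + 1] by rewrite -E imset_f // set21.
have pE1 : align k e (p + 1) \in [set p; p + 1] by rewrite -E imset_f // set22.
have n1 : 1 != 0 :> Zn by rewrite oner_neq0.
have n22 : 1 + 1 != 0 :> Zn := two_neq0 n2.
have cancel x y : x = y -> x - y = 0 :> Zn by move=> ->; rewrite subrr.
move: kep pE pE1; rewrite /edge_match -[1]/(sg false) alignD addbF.
rewrite !in_set2 {E} => kep /orP[]/eqP pE; rewrite pE in kep *.
  case: e pE {kep} => pE; rewrite /sg => /orP[]/eqP/cancel E.
  - by case/eqP: n1; rewrite -[LHS]opprK -[RHS]oppr0 -E; congr (- _); ring.
  - by case/eqP: n22; rewrite -[LHS]opprK -[RHS]oppr0 -E; congr (- _); ring.
  - by case/eqP: n1; rewrite -E; ring.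
  by case/eqP: k0; rewrite -(cancel _ _ pE) /align /sg; ring.
case: e pE kep => pE kep; rewrite /sg => /orP[]/eqP/cancel E.
- move: kep; rewrite (out_linv p false); case: (out p false) => x b.
  by rewrite /linv xpair_eqE andbC /=; case: b.
- move: kep; rewrite (out_linv p false); case: (out p false) => x b.
  by rewrite /linv xpair_eqE andbC /=; case: b.
- by case/eqP: n22; rewrite -E; ring.
by case/eqP: n1; rewrite -E; ring.
Qed.

(** For [w = a b] the only place is [k = 1]; a matched edge then gives [a = b],
    or, if the orientation is reversed, a letter equal to its inverse. *)
Lemma edge_match_length2 k e p : n = 2 -> k != 0 -> edge_match k e p ->
  exists a, w = [:: a; a].
Proof.
move=> n2 k0 kep; suff L01 : letter_at 0 = letter_at 1.
  exists (letter_at 0); move: L01; rewrite /letter_at.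
  rewrite (@val_natZ 1) // (@val_natZ 0) ?(ltnW n_gt1) //.
  by case: (w) n2 => [|a [|b []]] //= _ <-.
move: k0 kep; have E2 : 1 + 1 = 0 :> Zn by rewrite -natZn [in RHS](_ : n%:R = 2%:R) // n2.
have Z01 (c : Zn) : c = 0 \/ c = 1.
  have := ltn_Zn c; rewrite [X in (_ < X)%N]n2; have := natr_Zp c.
  by case: (c : nat) => [|[|]] // <- _; [left|right].
have [->|->] := Z01 k; first by rewrite eqxx.
move=> _; rewrite /edge_match /align /sg; case: e.
  have -> : 1 + -1 * p = p + 1.
    by have [->|->] := Z01 p; rewrite ?mulN1r ?subr0 ?subrr ?add0r.
  rewrite (out_linv p false); case: (out p false) => x b.
  by rewrite /linv xpair_eqE andbC /=; case: b.
have [->|->] := Z01 p; first by rewrite mulr0 addr0 => /eqP.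
by rewrite mulr1 E2 => /eqP.
Qed.

Hypothesis w_not_square : forall a, w <> [:: a; a].

Lemma edge_match_moved k e p : k != 0 -> edge_match k e p ->
  align k e @: [set p; p + 1] != [set p; p + 1].
Proof.
move=> k0 kep; apply: edge_match_neq => //; rewrite ltn_neqAle n_gt1 andbT eq_sym.
by apply/eqP => /edge_match_length2/(_ k0 kep)[a /w_not_square].
Qed.

(** Sparseness speaks of matched intervals that differ as sets from their
    image. They always do: after dropping an end the smaller interval is
    disjoint from its image, by induction, and if the bigger ones were equal
    they would have to contain both, although they have only one more element
    than each. *)
Lemma run_disjoint k e s t : k != 0 -> (0 < s + t < n)%N -> run k e s t ->
  [disjoint align k e @: interval s t & interval s t].
Proof.
move=> k0; have [m] := ubnP (s + t)%N.
elim: m s t => // m IHm s t lt_m st kst.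
suff neq : align k e @: interval s t != interval s t.
  by have [] := sparse_runs st kst neq st kst neq.
have [st1|st1] := eqVneq (s + t)%N 1.
  rewrite interval_edge //; apply: edge_match_moved => //.
  by have := kst 0%N; rewrite st1 sub0r; apply.
have [s' [t' [ss tt st' kst']]] : exists s' t',
    [/\ (s' <= s)%N, (t' <= t)%N, (s' + t').+1 = (s + t)%N & run k e s' t'].
  case: s st st1 kst {lt_m} => [|s] st st1 kst.
    by exists 0%N, t.-1; split=> //; [lia..|move=> r rt; apply: kst; lia].
  exists s, t; split=> // r rt; have := kst r.+1; rewrite addSn => /(_ rt).
  by congr edge_match; rewrite -!natr1; ring.
have dis := IHm s' t' _ _ kst'.
apply/eqP => E.
have sub : interval s' t' :|: align k e @: interval s' t' \subset interval s t.
  by rewrite finset.subUset interval_sub //= -E imsetS // interval_sub.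
have := subset_leq_card sub; rewrite cardsU.
have -> : interval s' t' :&: align k e @: interval s' t' = finset.set0.
  by apply/eqP; rewrite setI_eq0 disjoint_sym; apply: dis; lia.
by rewrite cards0 (card_imset _ (@align_inj k e)) !card_interval; lia.
Qed.

(** A matched interval and its image are disjoint and of the same size, so each
    covers at most half of the cycle. If the two arms met on the far side, the
    argument would apply to a matched interval exhausting the cycle. *)
Lemma arms_small k e : k != 0 -> (2 * (arm_bwd k e + arm_fwd k e).+1 <= n)%N.
Proof.
move=> k0; set S := arm_bwd k e; set T := arm_fwd k e.
have bound s t : (s <= S)%N -> (t <= T)%N -> (s + t < n)%N ->
    (2 * (s + t).+1 <= n)%N.
  move=> sS tT stn; have [st0|st0] := posnP (s + t)%N; first by rewrite st0.
  have := run_disjoint k0 _ (run_arms sS tT); rewrite st0 stn => /(_ isT).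
  rewrite -setI_eq0 => /eqP dis; rewrite -card_Zn.
  have := max_card (align k e @: interval s t :|: interval s t).
  rewrite cardsU dis cards0 (card_imset _ (@align_inj k e)) card_interval //.
  by move=> le; apply: leq_trans le; lia.
have [STn|nST] := ltnP (S + T) n; first exact: bound.
have : (2 * (minn S n.-1 + (n.-1 - minn S n.-1)).+1 <= n)%N by apply: bound; lia.
by lia.
Qed.

(** The orientation for which something can be folded. Without any, both arms
    are empty and the value is immaterial. *)
Definition flip k := (0 < arm_bwd k true + arm_fwd k true)%N.
Definition bwd k := arm_bwd k (flip k).
Definition fwd k := arm_fwd k (flip k).
Definition fold k p := align k (flip k) p.
Definition gate k : {set Zn} := interval (bwd k) (fwd k).
Definition glued k := (0 < bwd k + fwd k)%N.

Lemma gate_small k : k != 0 -> (2 * (bwd k + fwd k).+1 <= n)%N.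
Proof. exact: arms_small. Qed.

Lemma gate_match k r : (r < bwd k + fwd k)%N ->
  edge_match k (flip k) (r%:R - (bwd k)%:R).
Proof. exact: run_arms. Qed.

Lemma gate_maximal k p e : k != 0 -> p \in gate k ->
  out p e = out (fold k p) (flip k (+) e) -> p + sg e \in gate k.
Proof.
move=> k0 /intervalP[r rST ->] /eqP; rewrite /fold out_edge_match.
have small := gate_small k0; case: e; rewrite /sg => kep; apply/intervalP.
  case: r rST kep => [|r] rST kep; last first.
    by exists r; [exact: ltnW|rewrite -natr1; ring].
  have : (bwd k < n)%N by lia.
  move/arm_max/negP; case; rewrite -/(bwd k).
  by move: kep; congr edge_match; rewrite -natr1; ring.
have [rST'|STr] := ltnP r (bwd k + fwd k).
  by exists r.+1; [|rewrite -natr1; ring].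
have : (fwd k < n)%N by lia.
move/arm_max/negP; case; rewrite -/(fwd k).
have rE : r = (bwd k + fwd k)%N by lia.
by move: kep; congr edge_match; rewrite rE natrD; ring.
Qed.

(** The orientation [flip k] need not be [e] for this to hold: a match in either
    orientation makes the arms for [flip k] nonempty. *)
Lemma match_glued k e e' : out 0 e' = out k (e (+) e') -> glued k.
Proof.
rewrite -{1}(align0 k e) => /eqP; rewrite out_edge_match => kep.
have n0 := ltnW n_gt1.
have : (0 < arm_bwd k e + arm_fwd k e)%N.
  case: e' kep => kep; rewrite lt0n addn_eq0; apply/negP => /andP[/eqP S0 /eqP T0].
    have : (arm_bwd k e < n)%N by rewrite S0.
    by move/arm_max/negP; case; rewrite -/(arm_bwd k e) S0 -sub0r.
  have : (arm_fwd k e < n)%N by rewrite T0.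
  by move/arm_max/negP; case; rewrite -/(arm_fwd k e) T0.
rewrite /glued /bwd /fwd; case: e {kep}; first by move=> kep; rewrite /flip kep.
by rewrite /flip; case: (posnP (arm_bwd k true + arm_fwd k true)).
Qed.

Lemma gate_neighbour k p : glued k -> p \in gate k ->
  exists2 e, p + sg e \in gate k & out p e = out (fold k p) (flip k (+) e).
Proof.
move=> gk /intervalP[r rST ->].
have [rST'|STr] := ltnP r (bwd k + fwd k).
  exists false; last by apply/eqP; rewrite /fold out_edge_match gate_match.
  by apply/intervalP; exists r.+1 => //; rewrite /sg -natr1; ring.
case: r rST STr => [|r] rST STr; first by move: gk; rewrite /glued; lia.
exists true.
  by apply/intervalP; exists r; [exact: ltnW|rewrite /sg -natr1; ring].
apply/eqP; rewrite /fold out_edge_match.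
by have := gate_match rST; congr edge_match; rewrite -natr1; ring.
Qed.

Lemma zero_gate k : 0 \in gate k.
Proof. exact: zero_interval. Qed.

Lemma gate_unglued k p : ~~ glued k -> p \in gate k -> p = 0.
Proof.
rewrite /glued -eqn0Ngt addn_eq0 => /andP[/eqP S0 /eqP T0].
by case/intervalP=> r; rewrite S0 T0 leqn0 => /eqP-> ->; rewrite subrr.
Qed.

Lemma glued_run k : k != 0 -> glued k ->
  [/\ (0 < bwd k + fwd k < n)%N, run k (flip k) (bwd k) (fwd k) &
      align k (flip k) @: gate k != gate k].
Proof.
move=> k0 gk; have st : (0 < bwd k + fwd k < n)%N.
  by have := gate_small k0; move: gk; rewrite /glued; lia.
split=> //; first exact: run_arms.
have := run_disjoint k0 st (run_arms (leqnn _) (leqnn _)).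
apply: contraTneq; rewrite -/(gate k) => ->; apply/pred0Pn.
by exists 0; rewrite /= zero_gate.
Qed.

(** First sparseness condition. When nothing is folded at [k'] its gate is [0],
    which lies in the gate of [k] as well. *)
Lemma fold_notin_gate k k' p : k != 0 -> k' != 0 -> glued k ->
  p \in gate k -> fold k p \notin gate k'.
Proof.
move=> k0 k'0 gk kp.
have [st run neq] := glued_run k0 gk.
have [gk'|ngk'] := boolP (glued k').
  have [st' run' neq'] := glued_run k'0 gk'.
  have [/pred0P/(_ (fold k p)) /= + _] := sparse_runs st run neq st' run' neq'.
  by rewrite imset_f //= => ->.
apply/negP => /(gate_unglued ngk') kp0.
have [/pred0P/(_ (fold k p)) /= + _] := sparse_runs st run neq st run neq.
by rewrite imset_f //= kp0 zero_gate.
Qed.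

(** Second sparseness condition: meeting images belong to the same place. *)
Lemma fold_glued_inj k k' p p' : k != 0 -> k' != 0 -> glued k -> glued k' ->
  p \in gate k -> p' \in gate k' -> fold k p = fold k' p' -> k = k'.
Proof.
move=> k0 k'0 gk gk' kp kp' E.
have [st run neq] := glued_run k0 gk; have [st' run' neq'] := glued_run k'0 gk'.
have [_ [|[]//]] := sparse_runs st run neq st' run' neq'.
by move/pred0P/(_ (fold k p)) => /=; rewrite imset_f // E imset_f.
Qed.

(** The relator is cyclically reduced. At [0] this is not part of being freely
    reduced; but if the last letter were the inverse of the first, turning the
    cycle over at its base would match an edge at [0] while fixing [0]. *)
Lemma out_inj p e e' : out p e = out p e' -> e = e'.
Proof.
suff neq q : letter_at q != linv (letter_at (q - 1)).
  by case: e e' => -[] //; rewrite /out => E; case/eqP: (neq p).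
have [->|] := eqVneq q 0; last exact: sparse_letters.
have [n2|n2] := eqVneq n 2.
  have := sparse_letters (oner_neq0 Zn); rewrite subrr sub0r.
  have -> : -1 = 1 :> Zn.
    apply/eqP; rewrite eq_sym -addr_eq0 -natZn.
    by rewrite [in X in _ == X](_ : n%:R = 2%:R) // n2.
  by apply: contraNneq => ->; rewrite linvK.
have {}n2 : (2 < n)%N by rewrite ltn_neqAle n_gt1 eq_sym n2.
apply/eqP => E.
have run01 : run 0 true 0 1.
  by case=> // _; rewrite /edge_match subrr align0 /out E.
have neq : align 0 true @: interval 0 1 != interval 0 1.
  rewrite interval_edge // oppr0 add0r; apply/eqP => /setP/(_ 1).
  rewrite set22 imsetU1 imset_set1 in_set2 /align /sg mulr0 mulr1 !add0r.
  by rewrite (negbTE (oner_neq0 _)) -addr_eq0 (negbTE (two_neq0 n2)).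
have n1 : (0 < 0 + 1 < n)%N by rewrite add0n n_gt1.
have [/pred0P/(_ 0) /= + _] := sparse_runs n1 run01 neq n1 run01 neq.
by rewrite zero_interval -{1}(align0 0 true) imset_f // zero_interval.
Qed.

(** * Distances on one cycle *)

Definition lipschitz (f : Zn -> nat) := forall p e, (f (p + sg e)%R <= (f p).+1)%N.

Section Arc.
Context (S T : nat) (door : Zn -> nat).
Hypothesis small : (2 * (S + T).+1 <= n)%N.
Hypothesis door_lip : lipschitz door.

(** The distances to the root on a cycle whose gate is [interval S T], when those
    on the gate are given by [door]: outside the gate a path comes from the end
    [T] or from the end [- S]. *)
Definition arc_dist p : nat :=
  if p \in interval S T then door p else
  minn (door T%:R + (p - T%:R)%R) (door (- S%:R)%R + (n - (S + T) - (p - T%:R)%R)).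

Let len := (n - (S + T))%N.

(** On the arc, positions are counted from the end [T] of the gate: [len] is the
    other end, and the gate is the rest, together with [0]. *)
Lemma arc_coord p : exists2 j, (j < n)%N & p = T%:R + j%:R.
Proof. by exists (p - T%:R : Zn); [exact: ltn_Zn|rewrite natr_Zp addrC subrK]. Qed.

Lemma arc_interval j : (j <= n)%N ->
  (T%:R + j%:R \in interval S T) = (j == 0) || (len <= j)%N.
Proof.
move=> jn; apply/intervalP/orP => [[r rST E]|[/eqP->|lj]].
- have [rE|rST'] := eqVneq r (S + T)%N.
    have [jE|jn'] := eqVneq j n; first by right; rewrite jE leq_subr.
    left; apply/eqP; apply: natZ_inj; [lia|lia|].
    have -> : j%:R = T%:R + j%:R - T%:R :> Zn by ring.
    by rewrite E rE natrD; ring.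
  right; have [jE|jn'] := eqVneq j n; first by rewrite jE leq_subr.
  suff -> : j = (len + r)%N by rewrite leq_addr.
  apply: natZ_inj; [lia|rewrite /len; lia|].
  have -> : j%:R = T%:R + j%:R - T%:R :> Zn by ring.
  by rewrite E natrD natrB; [rewrite natZn natrD; ring|lia].
- by exists (S + T)%N => //; rewrite natrD; ring.
exists (j - len)%N; first by rewrite /len; lia.
by rewrite natrB // /len natrB; [rewrite natZn natrD; ring|lia].
Qed.

Lemma door_far r : (r <= S + T)%N ->
  (door (r%:R - S%:R)%R <= door (- S%:R)%R + r)%N /\
  (door (- S%:R)%R <= door (r%:R - S%:R)%R + r)%N.
Proof.
elim: r => [|r IHr] rST; first by rewrite sub0r addn0.
have := IHr (ltnW rST); have := door_lip (r%:R - S%:R) false.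
have := door_lip (r.+1%:R - S%:R) true.
have -> : r.+1%:R - S%:R + sg true = r%:R - S%:R :> Zn by rewrite -natr1 /sg; ring.
have -> : r%:R - S%:R + sg false = r.+1%:R - S%:R :> Zn by rewrite -natr1 /sg; ring.
by lia.
Qed.

Lemma door_ends : (door T%:R <= door (- S%:R)%R + (S + T))%N /\
  (door (- S%:R)%R <= door T%:R + (S + T))%N.
Proof. by have := door_far (leqnn _); rewrite natrD addrAC subrr add0r. Qed.

(** The formula for the arc is still correct at both ends of the gate, because
    the gate is the shorter way from one end to the other. *)
Lemma arc_distE j : (j <= len)%N ->
  arc_dist (T%:R + j%:R) = minn (door T%:R + j) (door (- S%:R)%R + (len - j)).
Proof.
move=> jl; have [d1 d2] := door_ends; rewrite /arc_dist.
rewrite arc_interval; last by rewrite /len in jl; lia.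
have [->|j0] := eqVneq j 0%N.
  by rewrite orTb addr0; rewrite /len; lia.
rewrite orFb; have [lj|lj] := leqP len j.
  have -> : j = len by lia.
  have -> : T%:R + len%:R = - S%:R :> Zn.
    by rewrite /len natrB; [rewrite natZn natrD; ring|lia].
  by rewrite /len; lia.
by rewrite addrAC subrr add0r val_natZ //; rewrite /len in lj; lia.
Qed.

Lemma arc_dist_door r : (r <= S + T)%N ->
  arc_dist (r%:R - S%:R) = door (r%:R - S%:R)%R.
Proof. by move=> rST; rewrite /arc_dist ifT //; apply/intervalP; exists r. Qed.

Lemma arc_dist_lip : lipschitz arc_dist.
Proof.
move=> p e.
have lip q : (arc_dist (q + 1)%R <= (arc_dist q).+1)%N /\
    (arc_dist q <= (arc_dist (q + 1)%R).+1)%N.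
  have [j jn ->] := arc_coord q; rewrite -addrA natr1.
  have [lj|jl] := leqP len j; last by rewrite !arc_distE //; lia.
  have coord i : (len <= i)%N -> T%:R + i%:R = (i - len)%:R - S%:R :> Zn.
    by move=> li; rewrite natrB // /len natrB; [rewrite natZn natrD; ring|lia].
  rewrite !coord ?(leqW lj) // !arc_dist_door; [|rewrite /len; lia..].
  rewrite subSn //; have := door_lip ((j - len)%:R - S%:R) false.
  have := door_lip ((j - len).+1%:R - S%:R) true.
  have -> : (j - len).+1%:R - S%:R + sg true = (j - len)%:R - S%:R :> Zn.
    by rewrite -natr1 /sg; ring.
  have -> : (j - len)%:R - S%:R + sg false = (j - len).+1%:R - S%:R :> Zn.
    by rewrite -natr1 /sg; ring.
  by [].
case: e; rewrite /sg; last by case: (lip p).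
by have [_] := lip (p - 1); rewrite subrK.
Qed.

Lemma arc_new_coord p : p \notin interval S T ->
  exists2 j, (0 < j < len)%N & p = T%:R + j%:R.
Proof.
have [j jn ->] := arc_coord p; rewrite arc_interval; last exact: ltnW.
by rewrite negb_or -lt0n -ltnNge => jl; exists j.
Qed.

Lemma arc_dist_down p : p \notin interval S T ->
  exists e, arc_dist p = (arc_dist (p + sg e)%R).+1.
Proof.
case/arc_new_coord=> j j0 ->.
have prev : T%:R + j%:R + sg true = T%:R + j.-1%:R :> Zn.
  by rewrite -[in LHS](prednK (n := j)) -?natr1 /sg ?addrA ?addrK //; lia.
have next : T%:R + j%:R + sg false = T%:R + j.+1%:R :> Zn by rewrite -addrA natr1.
have [le|lt] := leqP (door T%:R + j) (door (- S%:R)%R + (len - j)).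
  by exists true; rewrite prev !arc_distE; lia.
by exists false; rewrite next !arc_distE; lia.
Qed.

(** The gate is so short that re-entering it never leads away from it. *)
Lemma arc_dist_enter p e : p \notin interval S T -> p + sg e \in interval S T ->
  (arc_dist (p + sg e)%R < arc_dist p)%N.
Proof.
have [d1 d2] := door_ends; case/arc_new_coord=> j j0 ->.
have lenE : len = (n - (S + T))%N by [].
case: e.
  have -> : T%:R + j%:R + sg true = T%:R + j.-1%:R :> Zn.
    by rewrite -[in LHS](prednK (n := j)) -?natr1 /sg ?addrA ?addrK //; lia.
  by rewrite arc_interval; [move=> H; rewrite !arc_distE; lia|lia].
have -> : T%:R + j%:R + sg false = T%:R + j.+1%:R :> Zn by rewrite -addrA natr1.
by rewrite arc_interval; [move=> H; rewrite !arc_distE; lia|lia].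
Qed.

End Arc.

(** Adding a constant to the distances on the gate adds it everywhere; this is
    written without the constant, as equality of differences. *)
Lemma arc_dist_shift S T (door door' : Zn -> nat) p q :
  (forall p q, door p + door' q = door' p + door q)%N ->
  (arc_dist S T door p + arc_dist S T door' q =
   arc_dist S T door' p + arc_dist S T door q)%N.
Proof.
move=> dd; rewrite /arc_dist.
have := dd T%:R (- S%:R); have := dd p T%:R; have := dd p q.
have := dd T%:R q; have := dd (- S%:R) q; have := dd p (- S%:R).
by case: ifP; case: ifP; lia.
Qed.

(** * The tree of cycles *)

(** A sequence [c :: u] stands for the vertex at position [c] of the cycle based
    at the vertex [u], and so also for the cycle based at that vertex. *)
Implicit Types (u : seq Zn).

(** The root cycle has no parent; its gate is reduced to its base [0]. *)
Definition top_bwd u := if u is k :: _ then bwd k else 0%N.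
Definition top_fwd u := if u is k :: _ then fwd k else 0%N.
Definition top_gate u := interval (top_bwd u) (top_fwd u).

(** Positions in the gate are identified with vertices of the parent cycle, so
    they do not give new vertices. *)
Fixpoint valid u : bool :=
  if u is c :: u' then (c \notin top_gate u') && valid u' else true.

(** The vertex at position [p] of the cycle based at [u]. *)
Definition pos u p : seq Zn :=
  if p \in top_gate u then
    if u is k :: u' then fold k p :: u' else [::]
  else p :: u.

Fixpoint dist u : Zn -> nat :=
  arc_dist (top_bwd u) (top_fwd u)
    (if u is k :: u' then fun p => dist u' (fold k p) else fun=> 0%N).

Definition door u : Zn -> nat :=
  if u is k :: u' then fun p => dist u' (fold k p) else fun=> 0%N.

Lemma distE u : dist u = arc_dist (top_bwd u) (top_fwd u) (door u).
Proof. by case: u. Qed.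

Definition depth u := if u is c :: u' then dist u' c else 0%N.

Lemma top_gate_nil p : (p \in top_gate [::]) = (p == 0).
Proof.
apply/intervalP/eqP => [[[|r]] // _ ->|->]; first by rewrite subrr.
by exists 0%N; rewrite ?subrr.
Qed.

Lemma zero_top_gate u : 0 \in top_gate u.
Proof. exact: zero_interval. Qed.

Lemma valid_cons c u : valid (c :: u) -> c != 0 /\ valid u.
Proof.
case/andP=> cu vu; split=> //.
by apply: contraNneq cu => ->; exact: zero_top_gate.
Qed.

Lemma valid_head k u : valid (k :: u) -> k != 0.
Proof. by case/valid_cons. Qed.

Lemma fold0 k : fold k 0 = k.
Proof. exact: align0. Qed.

Lemma foldD k p e : fold k (p + sg e) = fold k p + sg (flip k (+) e).
Proof. exact: alignD. Qed.

Lemma pos0 u : pos u 0 = u.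
Proof. by rewrite /pos zero_top_gate; case: u => // k u; rewrite fold0. Qed.

(** One folding is enough: a position folded onto the parent is not folded again
    onto the grandparent. *)
Lemma fold_new k u p : valid (k :: u) -> p \in gate k -> fold k p \notin top_gate u.
Proof.
move=> ku kp; have k0 := valid_head ku.
have [gk|/gate_unglued/(_ kp) ->] := boolP (glued k); last first.
  by rewrite fold0; case/andP: ku.
case: u ku => [|k' u] ku.
  rewrite top_gate_nil; apply/negP => /eqP f0.
  by have := fold_notin_gate k0 k0 gk kp; rewrite f0 zero_gate.
have [_ /valid_head k'0] := valid_cons ku.
exact: fold_notin_gate.
Qed.

Lemma valid_pos u p : valid u -> valid (pos u p).
Proof.
rewrite /pos; case: ifP => [|pu vu]; last by rewrite /= pu.
case: u => // k u kp ku; have [_ vu] := valid_cons ku.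
by rewrite /= (fold_new ku kp).
Qed.

Lemma depth_pos u p : valid u -> depth (pos u p) = dist u p.
Proof.
move=> vu; rewrite /pos; case: ifP => // pu.
by rewrite distE /arc_dist pu; case: u vu pu.
Qed.

(** A vertex [c :: u] lies on the cycle [u], where it is new, and on children of
    that cycle whose gate reaches it, including the cycle based at it. *)
Variant pos_spec c u : seq Zn -> Zn -> Prop :=
| PosNew of c \notin top_gate u : pos_spec c u u c
| PosOld k p of p \in gate k & fold k p = c : pos_spec c u (k :: u) p.

Lemma posP c u x p : pos x p = c :: u -> pos_spec c u x p.
Proof.
rewrite /pos; case: ifP => [|px [<- <-]]; last by constructor; rewrite px.
by case: x => // k x kp [kpc <-]; constructor.
Qed.

Lemma pos_nil x p : pos x p = [::] -> x = [::] /\ p = 0.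
Proof.
rewrite /pos; case: ifP => //; case: x => [|k x] //.
by rewrite top_gate_nil => /eqP.
Qed.

Lemma pos_fold k u p : valid (k :: u) -> p \in gate k ->
  pos (k :: u) p = pos u (fold k p).
Proof.
by move=> ku kp; rewrite /pos /= ifT // ifN // fold_new.
Qed.

(** A gate is maximal, so where the labels of a cycle and of its parent agree
    they follow each other. Directions that do not correspond cannot agree: if
    something is folded at [p], a neighbouring edge is common to both cycles, and
    one of them would not be reduced; if nothing is folded, any agreement at the
    base would be a folding. *)
Lemma gate_step k p e e' : k != 0 -> p \in gate k ->
  out p e = out (fold k p) e' -> e' = flip k (+) e /\ p + sg e \in gate k.
Proof.
move=> k0 kp E; suff eE : e' = flip k (+) e.
  by split=> //; apply: gate_maximal => //; rewrite -eE.
have [gk|ngk] := boolP (glued k); last first.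
  case/negP: (ngk); move: E; rewrite (gate_unglued ngk kp) fold0.
  by move=> E; apply: (@match_glued k (e' (+) e) e); rewrite addbK.
have [d _ dE] := gate_neighbour gk kp.
have [ed|ne] := eqVneq e d; first by apply: (@out_inj (fold k p)); rewrite -E ed.
have de : d = ~~ e by case: (d) (e) ne => -[].
apply/eqP/negPn/negP => ne'.
have e'E : e' = flip k (+) d by case: (e') (e) (flip k) ne' de => -[] [] //= _ ->.
by move: ne; rewrite (@out_inj p e d) ?eqxx // dE -e'E.
Qed.

Lemma step_new_old k u p e e' : valid (k :: u) -> p \in gate k ->
  out p e = out (fold k p) e' ->
  pos (k :: u) (p + sg e) = pos u (fold k p + sg e').
Proof.
move=> ku kp /(gate_step (valid_head ku) kp)[-> kpe].
by rewrite pos_fold // foldD.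
Qed.

(** Otherwise something would be folded at [p], against [fold_notin_gate]. *)
Lemma gate_out0 k p e e' : k != 0 -> p != 0 -> p \in gate k -> out p e <> out 0 e'.
Proof.
move=> k0 p0 kp E; have gp : glued p.
  by apply: (@match_glued _ (e (+) e') e'); rewrite addbK.
by have := fold_notin_gate p0 k0 gp (zero_gate p); rewrite fold0 kp.
Qed.

(** Two cycles through the same vertex are equal, or parent and child, or
    children of the same cycle; in the last case they share no edge. *)
Lemma step_det x p e x' p' e' : valid x -> valid x' ->
  pos x p = pos x' p' -> out p e = out p' e' ->
  pos x (p + sg e) = pos x' (p' + sg e').
Proof.
move=> vx vx'; case E : (pos x p) => [|c u] E'.
  have [-> ->] := pos_nil E; have [-> ->] := pos_nil (esym E').
  by move/out_inj->.
have := posP (esym E'); case: (posP E) vx => [cu vu|k {}p kp kpc ku] {E E'};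
    move=> X'; case: X' vx' => [cu' vu'|k' {}p' kp' kpc' ku'].
- by move/out_inj->.
- by rewrite -kpc' => /esym/(step_new_old ku' kp').
- by rewrite -kpc => /(step_new_old ku kp).
have [k0 k'0] := (valid_head ku, valid_head ku').
have [kk|kk] := eqVneq k k'.
  move: kpc kp ku; rewrite {}kk -kpc' => /align_inj-> kp ku.
  by move/out_inj->.
have [gk|ngk] := boolP (glued k); have [gk'|ngk'] := boolP (glued k').
- by case/eqP: kk; apply: fold_glued_inj kp kp' _ => //; rewrite kpc.
- have p'0 := gate_unglued ngk' kp'; move: kpc; rewrite -kpc' p'0 fold0 => kpk'.
  have p0 : p != 0 by apply: contraNneq kk => p0; rewrite -kpk' p0 fold0.
  by move/(gate_out0 k0 p0 kp).
- have p0 := gate_unglued ngk kp; move: kpc; rewrite -kpc' p0 fold0 => kpk'.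
  have p'0 : p' != 0 by apply: contraNneq kk => p'0; rewrite kpk' p'0 fold0.
  by move/esym/(gate_out0 k'0 p'0 kp').
case/eqP: kk; rewrite -(fold0 k) -(fold0 k').
by rewrite -{1}(gate_unglued ngk kp) -(gate_unglued ngk' kp') kpc.
Qed.

Lemma top_gate_small u : valid u -> (2 * (top_bwd u + top_fwd u).+1 <= n)%N.
Proof. by case: u => [|k u] // /valid_head; exact: gate_small. Qed.

Lemma dist_door_lip u : valid u -> lipschitz (dist u) /\ lipschitz (door u).
Proof.
elim: u => [|k u IHu] vu; have lip := arc_dist_lip (top_gate_small vu).
  by rewrite distE; split=> //; exact: lip.
have [_ /IHu[lip_u _]] := valid_cons vu.
have lip_door : lipschitz (door (k :: u)).
  by move=> p e; rewrite /door foldD; exact: lip_u.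
by rewrite distE; split=> //; exact: lip.
Qed.

Lemma dist_lip u : valid u -> lipschitz (dist u).
Proof. by case/dist_door_lip. Qed.

Lemma door_lip u : valid u -> lipschitz (door u).
Proof. by case/dist_door_lip. Qed.

Lemma dist_down u p : valid u -> p \notin top_gate u ->
  exists e, dist u p = (dist u (p + sg e)).+1.
Proof.
move=> vu; rewrite distE; apply: arc_dist_down; first exact: top_gate_small.
exact: door_lip.
Qed.

Lemma dist_enter u p e : valid u -> p \notin top_gate u -> p + sg e \in top_gate u ->
  (dist u (p + sg e)%R < dist u p)%N.
Proof.
move=> vu; rewrite distE; apply: arc_dist_enter; first exact: top_gate_small.
exact: door_lip.
Qed.

(** The distances on a cycle vary by at most [n], so [profile] loses nothing. *)
Lemma dist_bound u p : valid u ->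
  (dist u p <= dist u 0%R + n)%N /\ (dist u 0%R <= dist u p + n)%N.
Proof.
move=> vu; rewrite -(natr_Zp p).
have: (p < n)%N by exact: ltn_Zn.
suff H m : (dist u m%:R <= dist u 0%R + m)%N /\ (dist u 0%R <= dist u m%:R + m)%N.
  by have := H p; lia.
elim: m => [|m IHm]; first by rewrite addn0.
have := dist_lip vu m%:R false; have := dist_lip vu m.+1%:R true.
by rewrite /sg natr1 -natr1 addrK; lia.
Qed.

(** The position on the parent determines the gate; together with the distances
    up to a constant, it determines everything that happens further down. *)
Definition same_cycle u u' : Prop :=
  ohead u = ohead u' /\ forall p q, (dist u p + dist u' q = dist u' p + dist u q)%N.

Definition profile u : {ffun Zn -> 'I_(2 * n).+1} :=
  [ffun p => inord (n + dist u p - dist u 0)].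

Lemma same_cycleP u u' : valid u -> valid u' ->
  ohead u = ohead u' -> profile u = profile u' -> same_cycle u u'.
Proof.
move=> vu vu' uu' /ffunP E; split=> // p q.
have H q1 : (n + dist u q1 - dist u 0%R = n + dist u' q1 - dist u' 0%R)%N.
  have := congr1 val (E q1); rewrite !ffunE /= !inordK //.
    by have := dist_bound q1 vu'; lia.
  by have := dist_bound q1 vu; lia.
have := H p; have := H q; have := dist_bound p vu; have := dist_bound p vu'.
by have := dist_bound q vu; have := dist_bound q vu'; lia.
Qed.

Lemma same_cycle_top u u' : same_cycle u u' ->
  top_bwd u = top_bwd u' /\ top_fwd u = top_fwd u'.
Proof. by case=> + _; case: u => [|k u]; case: u' => [|k' u'] //= [->]. Qed.

Lemma same_cycle_cons c u u' : same_cycle u u' -> same_cycle (c :: u) (c :: u').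
Proof.
by case=> _ uu'; split=> // p q; rewrite !distE; apply: arc_dist_shift => /= *.
Qed.

Definition state u : option (option Zn * {ffun Zn -> 'I_(2 * n).+1} * Zn) :=
  if u is c :: u' then Some (ohead u', profile u', c) else None.

Lemma state_cons c u v : valid (c :: u) -> valid v -> state (c :: u) = state v ->
  exists2 u', v = c :: u' & same_cycle u u'.
Proof.
case: v => // c' u' /valid_cons[_ vu] /valid_cons[_ vu'] [hd pr <-].
by exists u' => //; exact: same_cycleP.
Qed.

Lemma same_cycle_state c u u' : same_cycle u u' -> state (c :: u) = state (c :: u').
Proof.
case=> uu' dd /=; rewrite uu'; congr (Some (_, _, _)); apply/ffunP => p.
by rewrite !ffunE; congr inord; have := dd p 0; lia.
Qed.

Definition vertex := {u : seq Zn | valid u}.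

Implicit Types (v : vertex) (a : letter X).

Definition edge v a v' : Prop := exists x p e,
  [/\ valid x, val v = pos x p, a = out p e & val v' = pos x (p + sg e)].

Lemma edge_inv v a v' : edge v a v' -> edge v' (linv a) v.
Proof.
case=> x [p [e [vx vE -> tE]]]; exists x, (p + sg e), (~~ e).
by rewrite out_linv sgN addrK.
Qed.

Lemma edge_det v a v1 v2 : edge v a v1 -> edge v a v2 -> v1 = v2.
Proof.
case=> x [p [e [vx vE aE tE]]] [x' [p' [e' [vx' vE' aE' tE']]]].
by apply: val_inj; rewrite tE tE'; apply: step_det; rewrite -?vE -?aE.
Qed.

Lemma edge_depth v a v' : edge v a v' -> (depth (val v') <= (depth (val v)).+1)%N.
Proof.
by case=> x [p [e [vx -> _ ->]]]; rewrite !depth_pos //; exact: (dist_lip vx).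
Qed.

Definition root : vertex := exist (fun u => valid u) [::] isT.

Definition pos_vertex u p (vu : valid u) : vertex :=
  exist (fun u => valid u) (pos u p) (valid_pos p vu).

Lemma edge_down v : v = root \/
  exists v' a, edge v' a v /\ depth (val v) = (depth (val v')).+1.
Proof.
case: v => -[|c u] vcu; first by left; apply: val_inj.
right; have [cu _] := andP vcu; have [_ vu] := valid_cons vcu.
have [e de] := dist_down vu cu.
exists (pos_vertex (c + sg e) vu), (out (c + sg e) (~~ e)).
split; last by rewrite /= depth_pos.
exists u, (c + sg e), (~~ e); split=> //.
by rewrite sgN addrK /pos (negbTE cu).
Qed.

(** An ascending edge from a vertex [c :: u] stays on the cycle [u], where it does
    not enter the gate by [dist_enter], or follows a child of [u]. In both cases
    it has a copy at any vertex in the same state, as [same_cycle] passes from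
    cycles to their children. *)
Lemma edge_state v v' a (t : vertex) : state (val v) = state (val v') -> edge v a t ->
  depth (val t) = (depth (val v)).+1 ->
  exists t' : vertex, [/\ edge v' a t', depth (val t') = (depth (val v')).+1 &
                 state (val t') = state (val t)].
Proof.
case: v v' t => [v vv] [v' vv'] [t vt] /= vv'E.
case=> x [p [e [vx /= vE aE tE]]] dt.
suff [x' [vx' v'E d' tt']] : exists x', [/\ valid x', v' = pos x' p,
    dist x' (p + sg e) = (dist x' p).+1 & state (pos x' (p + sg e)) = state t].
  exists (pos_vertex (p + sg e) vx'); split=> //=.
    by exists x', p, e.
  by rewrite depth_pos // v'E depth_pos.
move: dt; rewrite tE vE !depth_pos // => dt.
case: v vv vE vv'E => [|c u] vcu vE vv'E.
  by exists x; split=> //; rewrite -vE; case: (v') vv'E.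
have [u' v'E uu'] := state_cons vcu vv' vv'E; rewrite v'E in vv' *.
have [bb ff] := same_cycle_top uu'.
have gg : top_gate u = top_gate u' by rewrite /top_gate bb ff.
have [_ vu'] := valid_cons vv'.
move: (posP (esym vE)) => pspec.
case: pspec vx dt {aE tE vE} => [cu vu|k {}p kp <- ku] dt.
  exists u'; split=> //; first by rewrite /pos -gg (negbTE cu).
    by have [_ /(_ (c + sg e) c)] := uu'; lia.
  have new : c + sg e \notin top_gate u.
    by apply/negP => /(dist_enter vu cu); rewrite dt; lia.
  by rewrite /pos -gg (negbTE new); apply/esym/same_cycle_state.
have kuu' := same_cycle_cons k uu'.
exists (k :: u'); split=> //.
- by case/andP: ku => kgu _; rewrite /= -gg kgu.
- by rewrite /pos kp.
- by have [_ /(_ (p + sg e) p)] := kuu'; lia.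
rewrite /pos; have -> : top_gate (k :: u') = top_gate (k :: u) by [].
by case: ifP => _; apply/esym/same_cycle_state.
Qed.

Lemma edge_loop v : walk edge v w v.
Proof.
pose at_ r : vertex := pos_vertex r%:R (valP v).
have at0 : at_ 0%N = v by apply: val_inj; rewrite /= pos0.
have atn : at_ n = v by apply: val_inj; rewrite /= natZn pos0.
suff H m : (m <= n)%N -> walk edge (at_ (n - m)%N) (drop (n - m) w) v.
  by have := H n (leqnn _); rewrite subnn drop0 at0.
elim: m => [_|m IHm mn]; first by rewrite subn0 drop_size.
have lt : (n - m.+1 < n)%N by lia.
rewrite (drop_nth x0) //=; have E : (n - m.+1).+1 = (n - m)%N by lia.
rewrite E; exists (at_ (n - m)%N); last exact: IHm (ltnW mn).
exists (val v), (n - m.+1)%:R, false; split=> //=; first exact: valP.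
  by rewrite /letter_at val_natZ.
by rewrite -E /sg natr1.
Qed.

(** * The tree of cycles inside the monoid *)

(** Each prefix of [w] is a right unit, so these words represent vertices of the
    Schuetzenberger graph. *)
Fixpoint vertex_word u : word X :=
  if u is c :: u' then vertex_word u' ++ take c w else [::].

Local Open Scope group_scope.

Definition pos_elt u p : Defs.Inv w := inv_pi w (vertex_word u ++ take p w).

Lemma pos_elt_unit u p : pos_elt u p * (pos_elt u p)^-1 = 1.
Proof.
have take_unit c : inv_pi w (take c w) * (inv_pi w (take c w))^-1 = 1.
  apply: (right_unit_factor (t := inv_pi w (drop c w))).
  by rewrite -inv_piM cat_take_drop inv_pi_relator.
rewrite /pos_elt inv_piM; apply: right_unitM => //.
elim: u => [|c u IHu] /=; first by rewrite invg1 mulg1.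
by rewrite inv_piM; apply: right_unitM.
Qed.

Lemma pos_elt_step u p e : pos_elt u (p + sg e)%R = pos_elt u p * inv_pi w [:: out p e].
Proof.
have fwd1 q : pos_elt u (q + 1)%R = pos_elt u q * inv_pi w [:: letter_at q].
  rewrite /pos_elt -inv_piM -catA -{1}(natr_Zp q) natr1.
  have -> : take q w ++ [:: letter_at q] = take q.+1 w.
    by rewrite (take_nth x0) ?ltn_Zn // cats1.
  have [qn|qn] := ltnP q.+1 n; first by rewrite val_natZ.
  have -> : q.+1 = n by have := ltn_Zn q; lia.
  by rewrite natZn take0 take_size cats0 inv_piM inv_pi_relator mulg1.
case: e; rewrite /sg; last exact: fwd1.
apply/esym/right_unit_back; first exact: pos_elt_unit.
by rewrite -fwd1 subrK.
Qed.

(** The folded edges carry the same labels, and in the monoid the end of an edge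
    is determined by its origin and its label; so the identification made by
    [pos] on the gate propagates in both directions from the common base. *)
Lemma pos_elt_fold k u p : p \in gate k -> pos_elt (k :: u) p = pos_elt u (fold k p).
Proof.
have step q e : pos_elt (k :: u) q = pos_elt u (fold k q) ->
    out q e = out (fold k q) (flip k (+) e) ->
    pos_elt (k :: u) (q + sg e)%R = pos_elt u (fold k (q + sg e)%R).
  by move=> qE oE; rewrite foldD !pos_elt_step qE oE.
have start : pos_elt (k :: u) 0%R = pos_elt u (fold k 0%R).
  by rewrite fold0 /pos_elt /= take0 cats0.
have forth r : (r <= fwd k)%N -> pos_elt (k :: u) r%:R%R = pos_elt u (fold k r%:R%R).
  elim: r => // r IHr rT; rewrite -natr1; apply: (step _ false); first exact/IHr/ltnW.
  apply/eqP; rewrite /fold out_edge_match.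
  have lt : (bwd k + r < bwd k + fwd k)%N by rewrite ltn_add2l.
  by have := gate_match lt; congr edge_match; rewrite natrD; ring.
have back s : (s <= bwd k)%N ->
    pos_elt (k :: u) (- s%:R)%R = pos_elt u (fold k (- s%:R)%R).
  elim: s => [|s IHs] sS; first by rewrite oppr0.
  have -> : (- s.+1%:R = - s%:R + sg true :> Zn)%R by rewrite -natr1 opprD.
  apply: step; first exact/IHs/ltnW.
  apply/eqP; rewrite /fold out_edge_match.
  have lt : (bwd k - s.+1 < bwd k + fwd k)%N by lia.
  by have := gate_match lt; congr edge_match; rewrite natrB // -natr1; ring.
case/intervalP=> r rST ->; have [Sr|rS] := leqP (bwd k) r.
  by rewrite -natrB //; apply: forth; lia.
by rewrite -opprB -natrB ?(ltnW rS) //; apply: back; lia.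
Qed.

Lemma pos_elt_pos u p : pos_elt (pos u p) 0%R = pos_elt u p.
Proof.
rewrite {1}/pos; case: ifP => [|_]; last by rewrite /pos_elt /= take0 cats0.
case: u => [|k u] kp.
  by move: kp; rewrite top_gate_nil => /eqP->.
by rewrite (pos_elt_fold _ kp) /pos_elt /= take0 cats0.
Qed.

Definition vertex_elt v : SG w := SG_of (pos_elt_unit (val v) 0%R).

Lemma vertex_elt_edge v a v' : edge v a v' -> SG_edge (vertex_elt v) a (vertex_elt v').
Proof.
case=> x [p [e [vx vE -> tE]]].
by rewrite /SG_edge /= vE tE !pos_elt_pos pos_elt_step.
Qed.

Lemma vertex_elt_root : vertex_elt root = SG_one w.
Proof. by apply: val_inj; rewrite /= /pos_elt /= take0. Qed.

(** * Regularity *)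

Theorem regular_tree_of_cycles :
  regular_language (geodesic_language w) /\ finite_set (range (cone_type (w := w))).
Proof.
apply: (@regular_of_model _ _ _ root edge edge_inv edge_det edge_loop vertex_elt
  (fun v => depth (val v)) vertex_elt_root vertex_elt_edge erefl edge_depth edge_down
  _ (fun v => state (val v))).
exact: edge_state.
Qed.

End CyclicWord.

Section SquareRelator.
Context (X : finType) (a : letter X).
Local Notation w := [:: a; a].
Local Open Scope group_scope.

(** With [a a = 1] the letter [a] is its own inverse, and both [a] and [linv a]
    exchange the two vertices. *)
Definition square_edge (v : bool) (b : letter X) (t : bool) : Prop :=
  b.1 = a.1 /\ t = ~~ v.

Lemma inv_pi_square : inv_pi w [:: a] * inv_pi w [:: a] = 1.
Proof. by rewrite -inv_piM; exact: inv_pi_relator. Qed.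

Definition square_elt (v : bool) : Defs.Inv w := if v then inv_pi w [:: a] else 1.

Lemma square_elt_unit v : square_elt v * (square_elt v)^-1 = 1.
Proof.
apply: (right_unit_factor (t := square_elt v)).
by case: v; rewrite ?mulg1 //; exact: inv_pi_square.
Qed.

Definition square_vertex v : SG w := SG_of (square_elt_unit v).

Lemma inv_pi_square_letter (b : letter X) :
  b.1 = a.1 -> inv_pi w [:: b] = inv_pi w [:: a].
Proof.
move=> ba; have [->//|ne] := eqVneq b a.
have -> : b = linv a.
  case: b a ba ne => [x c] [y d] /= ->; rewrite xpair_eqE eqxx /= /linv /=.
  by case: c d => -[].
rewrite inv_pi_linv.
have u := square_elt_unit true.
by rewrite -[LHS]mul1g -inv_pi_square -mulgA [X in _ * X]u mulg1.
Qed.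

Lemma square_vertex_edge v b t :
  square_edge v b t -> SG_edge (square_vertex v) b (square_vertex t).
Proof.
case=> ba ->; rewrite /SG_edge /= inv_pi_square_letter //.
by case: v; rewrite /= ?mul1g ?inv_pi_square.
Qed.

Lemma regular_square :
  regular_language (geodesic_language w) /\ finite_set (range (cone_type (w := w))).
Proof.
apply: (@regular_of_model _ _ _ false square_edge _ _ _ square_vertex nat_of_bool
  _ square_vertex_edge _ _ _ _ id) => //.
- by move=> v b t [ba ->]; rewrite /square_edge negbK.
- by move=> v b t t' [_ ->] [_ ->].
- by move=> v; exists (~~ v) => //; exists v => //; rewrite /square_edge negbK.
- exact: val_inj.
- by move=> v b t [_ ->]; case: v.
- by case; [right; exists false, a|left].
- by move=> v _ b t <- vt dt; exists t.
Qed.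

End SquareRelator.

Theorem theorem1p4 (X : finType) (w : word X) (hw : sparse w) :
  regular_language (geodesic_language w) /\
  finite_set (range (cone_type (w := w))).
Proof.
have [_ w_gt1 _] := hw.
have [[a ->]|nsq] := pselect (exists a, w = [:: a; a]); first exact: regular_square.
have x0 : letter X by case: (w) w_gt1.
by apply: (regular_tree_of_cycles x0 w_gt1 hw) => a wa; apply: nsq; exists a.
Qed.
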